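(* Let $n\ge 3$ and let $x_1,x_2,\dots,x_n$ be $n$ real numbers, with arithmetic mean $A$ and second and third moments $m_2'$ and $m_3'$. Then $$A\,m_{3}'\leq \frac{1}{2(n-1)}\left[(n-2)\,m_{2}'^{\,2}+n(n+1)\,m_{2}'A^{2}-n^{2}A^{4}\right].$$
   Context: For real numbers $x_1,\dots,x_n$: $A=\frac1n\sum_{i=1}^n x_i$, and $m_r'=\frac1n\sum_{i=1}^n x_i^r$ for $r=2,3$; $m_2'^{\,2}$ means $(m_2')^2$. *)

(* Defs.v *)
From HB Require Import structures.
From mathcomp Require Import all_boot all_order all_algebra.
From mathcomp Require Import reals.

Set Implicit Arguments.
Unset Strict Implicit.
Unset Printing Implicit Defensive.

Import Order.TTheory GRing.Theory Num.Theory.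
Local Open Scope ring_scope.

Definition arith_mean (R : realType) (n : nat) (x : 'I_n -> R) : R :=
  n%:R^-1 * \sum_(i < n) x i.

(* Moment about the origin, not about the mean. *)
Definition raw_moment (R : realType) (n : nat) (x : 'I_n -> R) (r : nat) : R :=
  n%:R^-1 * \sum_(i < n) x i ^+ r.

(* Main.v *)
(** Multiplying out, the claim is [2(n-2) e2^2 >= 3(n-1) e1 e3] for the elementary
symmetric functions (Newton's inequality). Write [x_i = A + y_i] with [sum y_i = 0]
and [q_r = sum y_i^r]. The claim becomes nonnegativity of the quadratic
[n(n-1)(n-2) q2 A^2 - 2n(n-1) q3 A + (n-2) q2^2] in [A]. This follows from the
skewness bound [|q3| <= (n-2) s q2], where [n(n-1) s^2 = q2], which is obtained by
summing [(y_i - (n-1)s) (y_i + s)^2 <= 0] over [i]. *)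
Require Import Defs.
From mathcomp Require Import all_boot all_order all_algebra.
From mathcomp Require Import reals.
From mathcomp Require Import ring lra.

Set Implicit Arguments.
Unset Strict Implicit.
Unset Printing Implicit Defensive.

Import Order.TTheory GRing.Theory Num.Theory.
Local Open Scope ring_scope.

(** This is Cauchy-Schwarz for the [n - 1] entries other than [y i], which sum to [- y i], phrased
    through squares measuring how far each [y j] lies from [- y i / (n - 1)]. *)
Lemma centered_sqr_le (R : realFieldType) (n : nat) (y : 'I_n -> R) (i : 'I_n) :
  (1 < n)%N -> \sum_(j < n) y j = 0 ->
  n%:R * y i ^+ 2 <= (n%:R - 1) * \sum_(j < n) y j ^+ 2.
Proof.
move=> n_gt1 sum0.
have N_gt1 : 1 < n%:R :> R by rewrite ltr1n.
have sumE : \sum_(j < n) ((n%:R - 1) * y j + y i) ^+ 2 =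
    (n%:R - 1) ^+ 2 * \sum_(j < n) y j ^+ 2 + n%:R * y i ^+ 2.
  transitivity (\sum_(j < n) ((n%:R - 1) ^+ 2 * y j ^+ 2
      + (2 * (n%:R - 1) * y i) * y j + y i ^+ 2)).
    by apply: eq_bigr => j _; ring.
  rewrite !big_split /= -!mulr_sumr sum0 sumr_const card_ord; ring.
(* Only the term [j = i] is kept; it equals [n ^ 2 * y i ^ 2]. *)
have : ((n%:R - 1) * y i + y i) ^+ 2 <=
    \sum_(j < n) ((n%:R - 1) * y j + y i) ^+ 2.
  rewrite (bigD1 i) //= lerDl; apply: sumr_ge0 => j _; exact: sqr_ge0.
rewrite sumE => le_sum.
rewrite -(@ler_pM2l _ (n%:R - 1)) ?subr_gt0 //; lra.
Qed.

(** The cubic in the summed inequality has its roots at the extremal configuration: one entry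
    [(n - 1) * s], all others [- s], where equality holds. *)
Lemma centered_cube_le (R : realFieldType) (n : nat) (y : 'I_n -> R) (s : R) :
  (1 < n)%N -> \sum_(j < n) y j = 0 -> 0 <= s ->
  \sum_(j < n) y j ^+ 2 = n%:R * (n%:R - 1) * s ^+ 2 ->
  \sum_(j < n) y j ^+ 3 <= (n%:R - 2) * s * \sum_(j < n) y j ^+ 2.
Proof.
move=> n_gt1 sum0 s_ge0 q2E.
have N_gt1 : 1 < n%:R :> R by rewrite ltr1n.
have y_le i : y i <= (n%:R - 1) * s.
  have := centered_sqr_le i n_gt1 sum0; rewrite q2E => le_sqr.
  have le2 : y i ^+ 2 <= ((n%:R - 1) * s) ^+ 2.
    by rewrite -(@ler_pM2l _ n%:R); [lra | lra].
  have r_ge0 : 0 <= (n%:R - 1) * s by apply: mulr_ge0 => //; lra.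
  apply: le_trans (ler_norm _) _.
  by rewrite -(ger0_norm r_ge0) -ler_sqr ?nnegrE // !real_normK ?num_real.
have sumE : \sum_(j < n) (y j - (n%:R - 1) * s) * (y j + s) ^+ 2 =
    \sum_(j < n) y j ^+ 3 - (n%:R - 3) * s * \sum_(j < n) y j ^+ 2
    - n%:R * (n%:R - 1) * s ^+ 3.
  transitivity (\sum_(j < n) (y j ^+ 3 + (- (n%:R - 3) * s) * y j ^+ 2
      + (s ^+ 2 - 2 * (n%:R - 1) * s ^+ 2) * y j + (- (n%:R - 1) * s ^+ 3))).
    by apply: eq_bigr => j _; ring.
  rewrite !big_split /= -!mulr_sumr sum0 sumr_const card_ord; ring.
have : \sum_(j < n) (y j - (n%:R - 1) * s) * (y j + s) ^+ 2 <= 0.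
  apply: sumr_le0 => j _; apply: mulr_le0_ge0; last exact: sqr_ge0.
  by rewrite subr_le0.
(* The constant term [n * (n - 1) * s ^ 3] is [s * q2], which raises the factor [n - 3] to
   [n - 2]. *)
rewrite sumE q2E; lra.
Qed.

Lemma centered_cube_norm_le (R : realFieldType) (n : nat) (y : 'I_n -> R) (s : R) :
  (1 < n)%N -> \sum_(j < n) y j = 0 -> 0 <= s ->
  \sum_(j < n) y j ^+ 2 = n%:R * (n%:R - 1) * s ^+ 2 ->
  `|\sum_(j < n) y j ^+ 3| <= (n%:R - 2) * s * \sum_(j < n) y j ^+ 2.
Proof.
move=> n_gt1 sum0 s_ge0 q2E.
rewrite ler_norml; apply/andP; split; last exact: centered_cube_le.
have q2N : \sum_(j < n) (- y j) ^+ 2 = \sum_(j < n) y j ^+ 2.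
  by apply: eq_bigr => j _; rewrite sqrrN.
have q3N : \sum_(j < n) (- y j) ^+ 3 = - \sum_(j < n) y j ^+ 3.
  by rewrite -sumrN; apply: eq_bigr => j _; ring.
(* The lower bound is the upper bound for [- y], which has the same [s]. *)
rewrite lerNl -q3N -q2N; apply: centered_cube_le => //.
  by rewrite sumrN sum0 oppr0.
by rewrite q2N.
Qed.

(** By the skewness bound, right side minus left side is at least [n * (n - 1) * (n - 2) * q2 * (|a|
    - s) ^ 2]. Real closedness supplies the square root [s]. *)
Lemma centered_newton (R : rcfType) (n : nat) (y : 'I_n -> R) (a : R) :
  (1 < n)%N -> \sum_(j < n) y j = 0 ->
  2 * n%:R * (n%:R - 1) * a * \sum_(j < n) y j ^+ 3 <=
    (n%:R - 2) * (n%:R * (n%:R - 1) * a ^+ 2 + \sum_(j < n) y j ^+ 2)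
      * \sum_(j < n) y j ^+ 2.
Proof.
move=> n_gt1 sum0.
have N_ge2 : 2 <= n%:R :> R by rewrite ler_nat.
set q2 := \sum_(j < n) y j ^+ 2; set q3 := \sum_(j < n) y j ^+ 3.
have q2_ge0 : 0 <= q2 by apply: sumr_ge0 => j _; exact: sqr_ge0.
have c_gt0 : 0 < n%:R * (n%:R - 1) :> R by apply: mulr_gt0; lra.
pose s := Num.sqrt (q2 / (n%:R * (n%:R - 1))).
have s_ge0 : 0 <= s by exact: sqrtr_ge0.
have q2E : q2 = n%:R * (n%:R - 1) * s ^+ 2.
  by rewrite sqr_sqrtr ?divr_ge0 ?(ltW c_gt0) // mulrC divfK ?gt_eqF.
have q3_le := centered_cube_norm_le n_gt1 sum0 s_ge0 q2E.
rewrite -/q2 -/q3 in q3_le.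
have aq3_le : a * q3 <= `|a| * ((n%:R - 2) * s * q2).
  apply: le_trans (ler_norm _) _; rewrite normrM.
  by apply: ler_wpM2l.
have sq_ge0 : 0 <= (n%:R - 2) * q2 * (`|a| - s) ^+ 2.
  apply: mulr_ge0; last exact: sqr_ge0.
  by apply: mulr_ge0 => //; lra.
have a2E : `|a| ^+ 2 = a ^+ 2 by rewrite real_normK ?num_real.
have : 2 * a * q3 <= (n%:R - 2) * q2 * (a ^+ 2 + s ^+ 2).
  by rewrite -a2E; lra.
rewrite -(ler_pM2l c_gt0) => le_c.
have -> : (n%:R - 2) * (n%:R * (n%:R - 1) * a ^+ 2 + q2) * q2 =
    n%:R * (n%:R - 1) * ((n%:R - 2) * q2 * (a ^+ 2 + s ^+ 2)).
  by rewrite [X in _ * (_ + X) * _]q2E; ring.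
by apply: le_trans le_c; rewrite le_eqVlt; apply/orP; left; apply/eqP; ring.
Qed.

Theorem theorem2p4 (R : realType) (n : nat) (hn : (3 <= n)%N) (x : 'I_n -> R) :
  arith_mean x * raw_moment x 3 <=
    1 / (2 * (n%:R - 1)) *
    ((n%:R - 2) * raw_moment x 2 ^+ 2
     + n%:R * (n%:R + 1) * raw_moment x 2 * arith_mean x ^+ 2
     - n%:R ^+ 2 * arith_mean x ^+ 4).
Proof.
have n_gt1 : (1 < n)%N by exact: ltnW.
have N_gt1 : 1 < n%:R :> R by rewrite ltr1n.
have N_neq0 : n%:R != 0 :> R by apply: lt0r_neq0; lra.
have N1_neq0 : n%:R - 1 != 0 :> R by apply: lt0r_neq0; lra.
set a := arith_mean x.
pose y i := x i - a.
have sum0 : \sum_(i < n) y i = 0.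
  rewrite big_split /= sumr_const card_ord -mulr_natl /a /arith_mean.
  by rewrite mulrN mulrA divff // mul1r subrr.
(* Both moments are expanded binomially in [x i = y i + a]; the terms linear in [y i] cancel by
   [sum0]. *)
have m2E : raw_moment x 2 = a ^+ 2 + n%:R^-1 * \sum_(i < n) y i ^+ 2.
  rewrite /raw_moment.
  have -> : \sum_(i < n) x i ^+ 2 =
      \sum_(i < n) (y i ^+ 2 + (2 * a) * y i + a ^+ 2).
    by apply: eq_bigr => i _; rewrite /y; ring.
  rewrite !big_split /= sumr_const card_ord -!mulr_sumr sum0.
  by field.
have m3E : raw_moment x 3 = a ^+ 3 + n%:R^-1 *
    (3 * a * \sum_(i < n) y i ^+ 2 + \sum_(i < n) y i ^+ 3).
  rewrite /raw_moment.
  have -> : \sum_(i < n) x i ^+ 3 =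
      \sum_(i < n) (y i ^+ 3 + (3 * a) * y i ^+ 2 + (3 * a ^+ 2) * y i + a ^+ 3).
    by apply: eq_bigr => i _; rewrite /y; ring.
  rewrite !big_split /= sumr_const card_ord -!mulr_sumr sum0.
  by field.
have := centered_newton a n_gt1 sum0.
rewrite m2E m3E -subr_ge0.
set q2 := \sum_(i < n) y i ^+ 2; set q3 := \sum_(i < n) y i ^+ 3 => newton.
rewrite -subr_ge0.
set d := (X in 0 <= X) in newton.
(* With this positive factor, [d] becomes exactly the difference of the two sides of the goal. *)
have d_scale_ge0 : 0 <= (2 * (n%:R - 1) * n%:R ^+ 2)^-1 * d.
  apply: mulr_ge0 => //; rewrite invr_ge0.
  by apply: mulr_ge0; [lra | exact: sqr_ge0].
by apply: le_trans d_scale_ge0 _; rewrite le_eqVlt; apply/orP; left; apply/eqP;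
  rewrite /d; field; rewrite N_neq0 N1_neq0.
Qed.
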